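(* Let $T$ be an $e$-positive tree with $n \ge 9$ vertices. Then \[ b_{(n-4,2,2)} \ge \left\lceil \frac{b_{(n-2,2)} + b_{(n-4,4)}}{2} \right\rceil, \] where $b_\lambda$ denotes the number of connected partitions of $T$ of type $\lambda$.
   Context: Chromatic symmetric function: for a graph $G$ with vertices $v_1,\dots,v_n$, $X_G=\sum_\kappa x_{\kappa(v_1)}\cdots x_{\kappa(v_n)}$, the sum over all proper colorings $\kappa:V(G)\to\{1,2,\dots\}$. For a partition $\lambda=(\lambda_1,\dots,\lambda_\ell)$, $e_\lambda=e_{\lambda_1}\cdots e_{\lambda_\ell}$ with $e_k=\sum_{j_1<\cdots<j_k}x_{j_1}\cdots x_{j_k}$. A graph $G$ is $e$-positive if all coefficients of $X_G$ in the basis $\{e_\lambda\}$ are non-negative. A connected partition of a graph $G$ is a set partition $\{B_1,\dots,B_k\}$ of $V(G)$ such that each $B_i$ induces a connected subgraph; its type is the integer partition formed by $|B_1|,\dots,|B_k|$ (order of parts is irrelevant). *)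

(* Defs.v *)
From mathcomp Require Import all_boot all_order all_algebra.
From mathcomp Require Import finmap multiset.

Set Implicit Arguments.
Unset Strict Implicit.
Unset Printing Implicit Defensive.

Import Order.TTheory GRing.Theory Num.Theory.

Section Graphs.
Variables (V : finType) (e : rel V).

Definition simple_graph : Prop := symmetric e /\ irreflexive e.

Definition induced (B : {set V}) : rel V :=
  [rel x y | [&& x \in B, y \in B & e x y]].

Definition connected_in (B : {set V}) : bool :=
  (B != set0) && [forall x in B, forall y in B, connect (induced B) x y].

(* In a simple graph the only duplicate-free cycles of length < 3 in the sense
   of [ucycle] are the empty one and the back-and-forth walks on an edge. *)
Definition acyclic : Prop := forall c : seq V, ucycle e c -> size c < 3.

Definition is_tree : Prop := [/\ simple_graph, connected_in setT & acyclic].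

Definition connected_partition (P : {set {set V}}) : bool :=
  partition P setT && [forall B in P, connected_in B].

Definition has_type (P : {set {set V}}) (l : seq nat) : bool :=
  perm_eq [seq #|B| | B : {set V} in P] l.

Definition nb_connected_partitions (l : seq nat) : nat :=
  #|[set P | connected_partition P & has_type P l]|.

Definition proper_coloring (k : {ffun V -> nat}) : Prop :=
  forall x y : V, e x y -> k x != k y.

End Graphs.

(* Imported only here because classical_sets shadows the names of finset. *)
From mathcomp Require Import boolp classical_sets functions cardinality fsbigop.

Local Open Scope classical_set_scope.
Local Open Scope ring_scope.

(* A monomial in the variables x_0, x_1, x_2, ... is the finite multiset of the
   indices of its factors (colors are numbered from 0 instead of 1), and a
   formal power series is the function giving its coefficients.  All sums
   [\sum_(i \in A)] below are over possibly infinite index sets, but have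
   finitely many nonzero terms, as shown by the [finite_*] lemmas. *)
Definition monom : choiceType := {mset nat}%mset.
Definition pseries : Type := monom -> rat.

Definition series_of_monom (m : monom) : pseries := fun m' => (m' == m)%:R.

(* x_{s_1} x_{s_2} ... x_{s_k} for s = [:: s_1; ...; s_k] *)
Definition prod_vars (s : seq nat) : pseries := series_of_monom (seq_mset s).

Definition psone : pseries := series_of_monom mset0.

Definition psmul (f g : pseries) : pseries := fun m =>
  \sum_(p \in [set p : monom * monom | (p.1 `+` p.2)%mset = m]) (f p.1 * g p.2).

Definition chromatic_sym (V : finType) (e : rel V) : pseries := fun m =>
  \sum_(k \in [set k : {ffun V -> nat} | proper_coloring e k])
    prod_vars [seq k v | v : V] m.

Definition elem_sym (k : nat) : pseries := fun m =>
  \sum_(s \in [set s : seq nat | sorted ltn s && (size s == k)]) prod_vars s m.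

Definition is_intpart (l : seq nat) : bool := sorted geq l && (0%N \notin l).
Definition intpart : choiceType := {l : seq nat | is_intpart l}.

Definition elem_sym_part (l : intpart) : pseries :=
  \big[psmul/psone]_(k <- val l) elem_sym k.

Definition e_expansion (f : pseries) (c : {fsfun intpart -> rat with 0}) : Prop :=
  forall m : monom, f m = \sum_(l <- finsupp c) c l * elem_sym_part l m.

(* The coefficients c are unique since the e_lambda are linearly independent. *)
Definition e_positive (V : finType) (e : rel V) : Prop :=
  exists c : {fsfun intpart -> rat with 0},
    e_expansion (chromatic_sym e) c /\ forall l : intpart, 0 <= c l.

Lemma finite_seqs (m : monom) : finite_set [set s : seq nat | seq_mset s = m].
Proof.
apply: (@sub_finite_set _ _ [set` permutations (enum_mset m)]); last exact: finite_seq.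
by move=> s /= <-; rewrite mem_permutations perm_sym perm_eq_seq_mset.
Qed.

Lemma finite_psmul (m : monom) :
  finite_set [set p : monom * monom | (p.1 `+` p.2)%mset = m].
Proof.
pose T := flatten [seq [seq (take i t, drop i t) | i <- iota 0 (size t).+1]
                  | t <- permutations (enum_mset m)].
pose S := [seq (seq_mset q.1 : monom, seq_mset q.2 : monom) | q <- T].
apply: (@sub_finite_set _ _ [set` S]); last exact: finite_seq.
move=> [a b] /= ab; apply/mapP; exists (enum_mset a, enum_mset b); last first.
  by rewrite /= !seq_mset_id.
apply/flatten_mapP; exists (enum_mset a ++ enum_mset b).
  rewrite mem_permutations; apply/allP => x _ /=.
  by rewrite count_cat !count_mem_mset -ab msetE2.
apply/mapP; exists (size (enum_mset a)); last by rewrite take_size_cat ?drop_size_cat.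
by rewrite mem_iota /= add0n ltnS size_cat leq_addr.
Qed.

Lemma finite_colorings (V : finType) (m : monom) :
  finite_set [set k : {ffun V -> nat} | seq_mset [seq k v | v : V] = m].
Proof.
pose S := [seq [ffun v => nth 0%N s (enum_rank v)] : {ffun V -> nat}
          | s <- permutations (enum_mset m)].
apply: (@sub_finite_set _ _ [set` S]); last exact: finite_seq.
move=> k /= km; apply/mapP; exists [seq k v | v : V].
  by rewrite mem_permutations -km perm_sym perm_eq_seq_mset.
apply/ffunP => v; rewrite ffunE (nth_map v) ?nth_enum_rank //.
by rewrite -cardE ltn_ord.
Qed.

(* Main.v *)
Require Import Defs.
From mathcomp Require Import all_boot all_order all_algebra all_field.
From mathcomp Require Import finmap multiset.
From mathcomp Require fsbigop.
From mathcomp Require Import ring zify.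
Set Implicit Arguments.
Unset Strict Implicit.
Unset Printing Implicit Defensive.
Import GRing.Theory Num.Theory.
Local Open Scope ring_scope.

(** Write n = d + 4 with d > 4.  The inequality comes from the non-negativity of one
coefficient of the e-expansion of X_T, that of e_(d,2,2), which equals

  n b_(n) + 4 d b_(d,2,2) - 2 (d+2) b_(d+2,2) - 2 d b_(d,4).

Once this number is known to be non-negative, b_(n) <= 1 and n < 2 d give
2 b_(d,2,2) > b_(d+2,2) + b_(d,4) - 1, hence the bound by integrality.

To compute the coefficient, expand X_T over edge subsets.  Removing an edge
of a tree disconnects its ends, so sending an edge subset to its components is
a bijection onto the connected partitions P of T, where P comes from n - |P|
edges.  Hence
X_T = sum_P (-1)^(n - |P|) prod_(B in P) p_|B| over connected partitions P
([tree_power_sum_expansion]).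

To read off the coefficient without developing the theory of symmetric
functions, evaluate X_T at two finite families of algebraic numbers, chosen
such that prod (1 + x_i X) is 1 + X^2 for the first one and 1 + X^2 + X^d for
the second one.  The difference of the two values is

- on the e side, sum_l c_l (prod e_(l_i) at the second family - the same at
  the first), which is non-negative term by term because the values of the e_k
  are 0 or 1 and grow from the first family to the second
  ([e_positive_monotone]);

- on the p side, a sum over connected partitions in which Newton's identities
  make nearly everything vanish: up to index n the power sums of the two
  families differ only at d, d+2 and n, while p_1 = p_3 = 0.  The types (n),
  (d+2,2), (d,4) and (d,2,2) are all that remains, with the weights displayed
  above ([power_sum_product_difference]).

The transfer from formal power series to values goes through lists of
monomials: on the monomials in the first N variables, every series that occurs
counts multiplicities in a finite list of monomials ([listed_by]), and products
of series correspond to products of lists. *)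

(** * Power sum expansion for trees *)

Definition block_constant (V : finType) (I : eqType) (P : {set {set V}})
    (k : V -> I) : bool :=
  [forall v, forall u in pblock P v, k u == k v].

(** A map that is constant on the blocks of P is the choice of one value per
block, so the sum factors over the blocks.  The element i0 is the default value
for the functions on sets of vertices away from P. *)
Lemma sum_block_constant (R : comPzSemiRingType) (V I : finType) (i0 : I)
    (w : I -> R) (P : {set {set V}}) : partition P [set: V] ->
  \sum_(k : {ffun V -> I} | block_constant P k) \prod_v w (k v)
  = \prod_(B in P) \sum_i w i ^+ #|B|.
Proof.
move=> partP; have [/eqP covP tiP P0] := and3P partP.
rewrite (big_distr_big i0).
pose at_block (k : {ffun V -> I}) (B : {set V}) := if [pick v in B] is Some v then k v else i0.
pose h (k : {ffun V -> I}) := [ffun B => if B \in P then at_block k B else i0].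
pose h' (f : {ffun {set V} -> I}) := [ffun v => f (pblock P v)].
have pbP v : pblock P v \in P by rewrite pblock_mem // covP inE.
rewrite [RHS](reindex_onto h h'); last first.
  move=> f /pffun_onP [/supportP fs _]; apply/ffunP => B; rewrite ffunE.
  case: ifP => [BP|/negbT BP]; last by rewrite fs.
  rewrite /at_block; case: pickP => [v vB|B0]; first by rewrite ffunE (def_pblock tiP BP vB).
  by case/negP: P0; suff <-: B = set0 by []; apply/setP => x; rewrite B0 inE.
have bc_at (k : {ffun V -> I}) B v : block_constant P k -> B \in P -> v \in B -> at_block k B = k v.
  move=> /forallP kc BP vB; rewrite /at_block.
  case: pickP => [u uB|/(_ v)]; last by rewrite vB.
  by have /forall_inP /(_ u) := kc v; rewrite (def_pblock tiP BP vB) => /(_ uB) /eqP.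
apply: eq_big => [k|k kc].
  apply/idP/andP => [kc|[_ /eqP hk]].
    split; last first.
      by apply/eqP/ffunP => v; rewrite !ffunE pbP (bc_at _ _ v) // mem_pblock covP inE.
    apply/pffun_onP; split => //; apply/supportP => B BP.
    by rewrite ffunE (negbTE BP).
  apply/forallP => v; apply/forall_inP => u uv.
  have pu : pblock P u = pblock P v by apply: def_pblock.
  by rewrite -hk !ffunE pu.
rewrite (eq_bigl (fun v => v \in [set: V])); last by move=> v; rewrite inE.
rewrite (set_partition_big _ partP) /=; apply: eq_bigr => B BP.
rewrite ffunE BP -prodr_const; apply: eq_bigr => v vB.
by rewrite (bc_at _ _ v).
Qed.

Section EdgeSubsets.
Variables (V : finType) (e : rel V).
Implicit Types (S : {set V * V}) (P : {set {set V}}).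

(** Ordering the endpoints represents each undirected edge by a single pair. *)
Definition edges : {set V * V} :=
  [set p | e p.1 p.2 && (enum_rank p.1 < enum_rank p.2)%N].

Definition edge_rel S : rel V := [rel x y | ((x, y) \in S) || ((y, x) \in S)].

Definition components S : {set {set V}} :=
  equivalence_partition (connect (edge_rel S)) [set: V].

Definition inner_edges P : {set V * V} := [set p in edges | p.2 \in pblock P p.1].

Definition constant_along (I : eqType) S (k : V -> I) : bool :=
  [forall p in S, k p.1 == k p.2].

Lemma connect_edge_relC S : connect_sym (edge_rel S).
Proof. by apply: sym_connect_sym => x y; rewrite /edge_rel /= orbC. Qed.

Lemma connect_edge_rel_equiv S :
  {in [set: V] & &, equivalence_rel (connect (edge_rel S))}.
Proof.
move=> x y z _ _ _; split; first exact: connect0.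
by move=> xy; apply: (same_connect (@connect_edge_relC S) xy).
Qed.

Lemma components_partition S : partition (components S) [set: V].
Proof. exact/equivalence_partitionP/connect_edge_rel_equiv. Qed.

Lemma mem_pblock_components S x y :
  (y \in pblock (components S) x) = connect (edge_rel S) x y.
Proof.
by rewrite pblock_equivalence_partition ?inE //; apply: connect_edge_rel_equiv.
Qed.

Lemma connect_invariant (I : eqType) (r : rel V) (k : V -> I) x y :
  (forall x y, r x y -> k x = k y) -> connect r x y -> k x = k y.
Proof.
move=> rk /connectP [p]; elim: p x => [|z p IH] x /= => [_ ->//|/andP[xz pz] yl].
by rewrite (rk _ _ xz); apply: IH.
Qed.

Lemma constant_along_components (I : eqType) S (k : V -> I) :
  constant_along S k = block_constant (components S) k.
Proof.
apply/forall_inP/forallP => [kS v|kc p pS].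
  apply/forall_inP => u; rewrite mem_pblock_components => vu.
  apply/eqP/esym; apply: connect_invariant vu => x y /orP [] /kS /eqP //.
have /forall_inP /(_ p.2) := kc p.1; rewrite mem_pblock_components eq_sym; apply.
by apply: connect1; rewrite /edge_rel /= -surjective_pairing pS.
Qed.

Lemma prod_components (R : comPzSemiRingType) (I : finType) (i0 : I) (w : I -> R) S :
  \sum_(k : {ffun V -> I} | constant_along S k) \prod_v w (k v)
  = \prod_(B in components S) \sum_i w i ^+ #|B|.
Proof.
rewrite -(sum_block_constant i0 w (components_partition S)).
by apply: eq_bigl => k; apply: constant_along_components.
Qed.

(** Counting two-valued maps turns the number of components into a cardinal that
can be compared under the removal of an edge; see [card_components]. *)
Lemma card_constant_along S :
  #|[set k : {ffun V -> bool} | constant_along S k]| = (2 ^ #|components S|)%N.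
Proof.
have /= := prod_components true (fun _ : bool => 1%N) S.
rewrite (eq_bigr (fun=> 1%N)) => [|k _]; last by rewrite big1_eq.
rewrite cardsE -sum1_card => ->.
rewrite (eq_bigr (fun=> 2%N)) => [|B _]; first by rewrite prod_nat_const.
by rewrite big_bool /= !expr1n.
Qed.

Hypothesis e_tree : is_tree e.

Let e_sym : symmetric e. Proof. by case: e_tree => [[]]. Qed.
Let e_irr : irreflexive e. Proof. by case: e_tree => [[]]. Qed.

Lemma sub_edge_rel S : S \subset edges -> subrel (edge_rel S) e.
Proof.
move=> /subsetP Se x y /orP [] /Se; rewrite inE => /andP [] //=.
by rewrite e_sym.
Qed.

Lemma edge_rel_edges x y : e x y -> edge_rel edges x y.
Proof.
move=> exy; rewrite /edge_rel /= !inE /= exy e_sym exy /=.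
case: ltngtP => // /ord_inj /enum_rank_inj xy.
by rewrite xy e_irr in exy.
Qed.

(** A shortest path in S between the ends of p, closed by p itself, would be a
cycle of the tree. *)
Lemma tree_edge_not_connected S p : S \subset edges -> p \in edges -> p \notin S ->
  ~~ connect (edge_rel S) p.1 p.2.
Proof.
move=> Se pe pS; apply/negP => /connectP [q0 pathq0 lastq0].
case/shortenP: pathq0 lastq0 => q pathq uniqq _ lastq.
have [_ _ /(_ (p.1 :: q))] := e_tree; rewrite /ucycle uniqq andbT /= rcons_path.
rewrite -lastq (sub_path (sub_edge_rel Se) pathq) /=.
move: (pe); rewrite inE => /andP [pe1 pe2]; rewrite e_sym pe1 => /(_ isT).
case: q lastq pathq uniqq => [|a [|b q]] //= lastq.
  by rewrite lastq ltnn in pe2.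
rewrite -lastq /edge_rel /= -surjective_pairing (negbTE pS) /= andbT => p21S.
have := subsetP Se _ p21S; rewrite inE /= ltnNge => /andP [_].
by rewrite ltnW.
Qed.

(** The ends of p lie in different components of S, so exchanging the two values
on the component of p.1 is an involution of the maps constant along S, and it
swaps those that agree at the ends of p with those that do not. *)
Lemma card_constant_alongD1 S p : S \subset edges -> p \in edges -> p \notin S ->
  #|[set k : {ffun V -> bool} | constant_along S k]|
  = (2 * #|[set k : {ffun V -> bool} | constant_along (p |: S) k]|)%N.
Proof.
move=> Se pe pS; have nc := tree_edge_not_connected Se pe pS.
set A := [set k : {ffun V -> bool} | constant_along S k]; set B := [set k | _].
pose flip (k : {ffun V -> bool}) :=
  [ffun v => connect (edge_rel S) p.1 v (+) k v].
have flipK : involutive flip.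
  by move=> k; apply/ffunP => v; rewrite !ffunE addbA addbb.
have flipS (k : {ffun V -> bool}) : constant_along S (flip k) = constant_along S k.
  suff F (k1 : {ffun V -> bool}) : constant_along S k1 -> constant_along S (flip k1).
    by apply/idP/idP; [rewrite -{2}[k]flipK|]; exact: F.
  move=> /forall_inP kS; apply/forall_inP => q qS; rewrite !ffunE (eqP (kS q qS)).
  rewrite (same_connect_r (@connect_edge_relC S) (x := q.1) (y := q.2)) //.
  by apply: connect1; rewrite /edge_rel /= -surjective_pairing qS.
have flipp (k : {ffun V -> bool}) : (flip k p.1 == flip k p.2) = (k p.1 != k p.2).
  by rewrite !ffunE connect0 (negbTE nc) /=; case: (k p.1); case: (k p.2).
have Bsub : B = A :&: [set k : {ffun V -> bool} | k p.1 == k p.2].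
  apply/setP => k; rewrite !inE; apply/forall_inP/andP => [kS|[/forall_inP kS kp] q].
    by split; [apply/forall_inP => q qS|]; apply: kS; rewrite !inE ?eqxx ?qS ?orbT.
  by rewrite !inE => /orP [/eqP -> //|/kS].
have -> : A = B :|: flip @: B.
  apply/setP => k; rewrite Bsub !inE; apply/idP/orP => [kA|].
    have [kp|kp] := boolP (k p.1 == k p.2); [by left; rewrite kA|right].
    by apply/imsetP; exists (flip k); rewrite ?flipK // !inE flipS kA flipp.
  case=> [/andP [] //|/imsetP [k1]].
  by rewrite !inE => /andP [k1S _] ->; rewrite flipS.
rewrite cardsU (_ : B :&: _ = set0) ?cards0 ?subn0.
  by rewrite card_imset ?mul2n ?addnn //; apply: can_inj flipK.
apply/setP => k; rewrite Bsub !inE; apply/negP => /andP [/andP [_ kp]] /imsetP [k1].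
by rewrite !inE => /andP [_ k1p] kk; rewrite kk flipp k1p in kp.
Qed.

(** By induction on S: two-valued maps constant along S number 2 to the power
of the number of components, and each edge halves their number. *)
Lemma card_components S : S \subset edges -> (#|S| + #|components S| = #|V|)%N.
Proof.
move: {2}#|S| (erefl #|S|) => m; elim: m S => [|m IH] S Sm Se.
  have S0 : S = set0 by apply/eqP; rewrite -cards_eq0 Sm.
  rewrite Sm add0n; apply/eqP; rewrite -(eqn_exp2l (m := 2)) // -card_constant_along.
  rewrite -[in X in _ == X]card_bool -card_ffun -cardsT; apply/eqP/eq_card => k.
  by rewrite !inE S0; apply/forall_inP => p; rewrite inE.
have [p pS] : exists p, p \in S by apply/card_gt0P; rewrite Sm.
have pN : p \notin S :\ p by rewrite setD11.
have S'e : S :\ p \subset edges by apply: subset_trans Se; rewrite subD1set.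
have S'm : #|S :\ p| = m by have := cardsD1 p S; rewrite pS Sm => -[].
have := card_constant_alongD1 S'e (subsetP Se p pS) pN.
rewrite setD1K // !card_constant_along -expnS => /eqP; rewrite eqn_exp2l // => /eqP c.
by rewrite -(IH _ S'm S'e) S'm c Sm addSnnS.
Qed.

Lemma components_connected S : S \subset edges -> connected_partition e (components S).
Proof.
move=> Se; rewrite /connected_partition components_partition /=.
have /and3P [_ tiP P0] := components_partition S.
apply/forall_inP => B BP; rewrite /connected_in; apply/andP; split.
  by apply: contraNneq P0 => <-.
apply/forall_inP => x xB; apply/forall_inP => y yB.
have memB z : (z \in B) = connect (edge_rel S) x z.
  by rewrite -mem_pblock_components (def_pblock tiP BP xB).
move: yB; rewrite memB => /connectP [q pathq ->].
apply/connectP; exists q => //.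
have : all (fun z => z \in B) (x :: q).
  apply/allP => z zq; rewrite memB.
  by have := path_connect pathq zq.
elim: q x {xB memB} pathq => [|z q IH] x //= /andP [xz pathq] /and3P [xB zB qB].
by rewrite {1}/induced /= xB zB (sub_edge_rel Se xz) IH //= zB.
Qed.

(** This and [components_inner_edges] make edge subsets and connected partitions
of a tree correspond to each other. *)
Lemma inner_edges_components S : S \subset edges -> inner_edges (components S) = S.
Proof.
move=> Se; apply/setP => p; rewrite in_set mem_pblock_components.
apply/andP/idP => [[pe]|pS].
  by apply: contraLR => pS; apply: tree_edge_not_connected.
split; first exact: (subsetP Se).
by apply: connect1; rewrite /edge_rel /= -surjective_pairing pS.
Qed.

Lemma components_inner_edges P : connected_partition e P -> 
  components (inner_edges P) = P.
Proof.
move=> /andP [partP /forall_inP conP].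
have [/eqP covP tiP P0] := and3P partP.
rewrite -[RHS](equivalence_partition_pblock partP) /components /equivalence_partition.
have inv x y : edge_rel (inner_edges P) x y -> pblock P x = pblock P y.
  suff F a b : (a, b) \in inner_edges P -> pblock P a = pblock P b.
    by case/orP => /F.
  by rewrite inE => /andP [_ /= ba]; apply/esym/def_pblock; rewrite // pblock_mem // covP inE.
suff E x y : connect (edge_rel (inner_edges P)) x y = (y \in pblock P x).
  by apply: eq_imset => x; apply/setP => y; rewrite !inE E.
have pbP v : pblock P v \in P by rewrite pblock_mem // covP inE.
have mpb v : v \in pblock P v by rewrite mem_pblock covP inE.
apply/idP/idP => [/(connect_invariant inv) -> //|yx].
have /andP [_ /forall_inP /(_ x (mpb x)) /forall_inP /(_ y yx)] := conP _ (pbP x).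
apply: connect_sub => a b /and3P [ax bx eab]; apply: connect1.
have pa := def_pblock tiP (pbP x) ax; have pb := def_pblock tiP (pbP x) bx.
have /orP [abE|baE] := edge_rel_edges eab.
  by apply/orP; left; rewrite inE abE /= pa bx.
by apply/orP; right; rewrite inE baE /= pb ax.
Qed.

Definition is_proper (I : eqType) (k : V -> I) : bool :=
  [forall x, forall y, e x y ==> (k x != k y)].

(** Expand the product over the edges p of 1 - [k p.1 = k p.2], which is the
indicator of proper colorings. *)
Lemma sum_proper_edge_subsets (R : comNzRingType) (I : finType) (w : I -> R) :
  \sum_(k : {ffun V -> I} | is_proper k) \prod_v w (k v)
  = \sum_(S : {set V * V} | S \subset edges) (-1) ^+ #|S| *
      \sum_(k : {ffun V -> I} | constant_along S k) \prod_v w (k v).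
Proof.
under [RHS]eq_bigr do rewrite big_distrr /= big_mkcond /=.
rewrite [LHS]big_mkcond exchange_big /=; apply: eq_bigr => k _.
pose F p : R := if p \in edges then - (k p.1 == k p.2)%:R else 0.
have : \prod_p (F p + 1) = (is_proper k)%:R.
  have [kP|/forallPn [x /forallPn [y]]] := boolP (is_proper k).
    apply: big1 => p _; rewrite /F; case: ifP; last by rewrite add0r.
    rewrite inE => /andP [pe _].
    have /forallP /(_ p.1) /forallP /(_ p.2) := kP; rewrite pe => /negbTE -> /=.
    by rewrite oppr0 add0r.
  rewrite negb_imply negbK => /andP [exy kxy].
  have /orP [xyE|yxE] := edge_rel_edges exy.
    by rewrite (bigD1 (x, y)) //= /F xyE /= kxy addNr mul0r.
  by rewrite (bigD1 (y, x)) //= /F yxE /= eq_sym kxy addNr mul0r.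
rewrite bigA_distr => prodF.
transitivity ((is_proper k)%:R * \prod_v w (k v)).
  by case: (is_proper k); rewrite ?mul1r ?mul0r.
rewrite -prodF big_distrl [RHS]big_mkcond /=; apply: eq_bigr => S _.
rewrite -big_mkcond /=; case: ifPn => [/subsetP Se|/subsetPn [p pS pE]]; last first.
  by rewrite (bigD1 p) //= /F (negbTE pE) !mul0r.
rewrite (eq_bigr (fun p => - (k p.1 == k p.2)%:R)) => [|p pS]; last by rewrite /F Se.
rewrite prodrN; case: ifPn => [/forall_inP kS|/forall_inPn [p pS kp]].
  by rewrite big1 ?mulr1 // => p /kS ->.
by rewrite [X in _ * X * _](bigD1 p) //= (negbTE kp) mul0r mulr0 mul0r.
Qed.

(** The power sum expansion of the chromatic symmetric function of a tree,
restricted to finitely many variables. *)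
Theorem tree_power_sum_expansion (R : comNzRingType) (I : finType) (i0 : I) (w : I -> R) :
  \sum_(k : {ffun V -> I} | is_proper k) \prod_v w (k v)
  = \sum_(P | connected_partition e P)
      (-1) ^+ (#|V| - #|P|) * \prod_(B in P) \sum_i w i ^+ #|B|.
Proof.
rewrite sum_proper_edge_subsets.
rewrite [RHS](reindex_onto components inner_edges); last exact: components_inner_edges.
apply: eq_big => [S|S Se].
  apply/idP/andP => [Se|[_ /eqP <-]].
    by rewrite components_connected // inner_edges_components.
  by apply/subsetP => p; rewrite inE => /andP [].
by rewrite (prod_components i0) -(card_components Se) addnK.
Qed.

End EdgeSubsets.

(** * Evaluating symmetric power series in finitely many variables *)

Definition bounded_monom (N : nat) (m : monom) : bool :=
  all (fun i => (i < N)%N) (enum_mset m).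

(** Restricting to the monomials in the first N variables makes each coefficient
of the series at hand a multiplicity in a finite list. *)
Definition listed_by (N : nat) (f : pseries) (s : seq monom) : Prop :=
  all (bounded_monom N) s /\
  forall m, bounded_monom N m -> f m = (count_mem m s)%:R.

Definition monom_eval (R : comNzRingType) (x : nat -> R) (m : monom) : R :=
  \prod_(i <- enum_mset m) x i.

Lemma bounded_seq_mset N (s : seq nat) :
  bounded_monom N (seq_mset s) = all (fun i => (i < N)%N) s.
Proof. exact/perm_all/perm_eq_seq_mset. Qed.

Lemma bounded_mset0 N : bounded_monom N mset0.
Proof. by rewrite /bounded_monom enum_mset0. Qed.

Lemma enum_msetD (a b : monom) : perm_eq (enum_mset (a `+` b)%mset) (enum_mset a ++ enum_mset b).
Proof.
by apply/allP => i _; rewrite /= count_cat !count_mem_mset msetE2.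
Qed.

Lemma bounded_msetD N (a b : monom) :
  bounded_monom N (a `+` b)%mset = bounded_monom N a && bounded_monom N b.
Proof. by rewrite /bounded_monom (perm_all _ (enum_msetD a b)) all_cat. Qed.

Lemma monom_eval_seq (R : comNzRingType) (x : nat -> R) (s : seq nat) :
  monom_eval x (seq_mset s) = \prod_(i <- s) x i.
Proof. exact/perm_big/perm_eq_seq_mset. Qed.

Lemma monom_evalD (R : comNzRingType) (x : nat -> R) (a b : monom) :
  monom_eval x (a `+` b)%mset = monom_eval x a * monom_eval x b.
Proof. by rewrite /monom_eval (perm_big _ (enum_msetD a b)) big_cat. Qed.

Lemma sum_count_undup (R : pzSemiRingType) (T : eqType) (s r : seq T) (F : T -> R) :
  uniq r -> {subset s <= r} ->
  \sum_(a <- s) F a = \sum_(a <- r) (count_mem a s)%:R * F a.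
Proof.
move=> r_uniq; elim: s => [|a s IH] sr.
  by rewrite big_nil big1 // => a _; rewrite mul0r.
rewrite big_cons IH; last by move=> b bs; apply: sr; rewrite inE bs orbT.
under [RHS]eq_bigr do rewrite /= natrD mulrDl.
rewrite big_split /=; congr (_ + _).
rewrite (bigD1_seq a) ?sr ?mem_head //= eqxx mul1r big1 ?addr0 // => b ba.
by rewrite eq_sym (negbTE ba) mul0r.
Qed.

Lemma fsum_list (R : nmodType) (T : choiceType) (A : classical_sets.set T) (r : seq T)
    (f : T -> R) :
  uniq r -> (forall i, i \in r -> A i) -> (forall i, A i -> i \notin r -> f i = 0) ->
  \sum_(i <- fsbigop.finite_support 0 A f) f i = \sum_(i <- r) f i.
Proof.
move=> r_uniq rA f0; rewrite (fsbigop.fsbigE r) // big_mkcond [LHS]big_seq [RHS]big_seq /=.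
by apply: eq_bigr => i /rA Ai; rewrite classical_sets.mem_set.
Qed.

Lemma listed_psone N : listed_by N psone [:: mset0].
Proof.
split=> [|m _]; first by rewrite /= bounded_mset0.
by rewrite /psone /series_of_monom /= addn0 eq_sym.
Qed.

Lemma natr_count (R : pzSemiRingType) (T : Type) (a : pred T) (s : seq T) :
  (count a s)%:R = \sum_(i <- s) (a i)%:R :> R.
Proof. by rewrite -sum1_count natr_sum big_mkcond; apply: eq_bigr => i _; case: (a i). Qed.

(** A factorization of a monomial in the first N variables only involves these
variables, so the Cauchy product only meets monomials of s and t. *)
Lemma listed_psmul N (f g : pseries) (s t : seq monom) :
  listed_by N f s -> listed_by N g t ->
  listed_by N (psmul f g) [seq (a `+` b)%mset | a <- s, b <- t].
Proof.
move=> [bs fs] [bt gt]; split=> [|m bm].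
  apply/allP => _ /allpairsP [[a b] [/= /(allP bs) ba /(allP bt) bb ->]].
  by rewrite bounded_msetD ba.
rewrite natr_count big_allpairs_dep /= /psmul.
rewrite (sum_count_undup _ (undup_uniq s)); last by move=> a; rewrite mem_undup.
have tu : {subset t <= undup t} by move=> b; rewrite mem_undup.
under [RHS]eq_bigr do rewrite (sum_count_undup _ (undup_uniq t) tu) big_distrr /=.
rewrite (fsum_list (r := [seq p <- [seq (a, b) | a <- undup s, b <- undup t] |
   (p.1 `+` p.2)%mset == m])); first last.
- move=> [a b] /= abm; rewrite mem_filter /= abm eqxx /= => nin.
  have [ba bb] : bounded_monom N a /\ bounded_monom N b.
    by apply/andP; rewrite -bounded_msetD abm.
  rewrite fs // gt //; case: (boolP (a \in s)) => [ins|/count_memPn ->]; last by rewrite mul0r.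
  case: (boolP (b \in t)) => [int|/count_memPn ->]; last by rewrite mulr0.
  by case/negP: nin; apply/allpairsP; exists (a, b); rewrite !mem_undup.
- by move=> [a b]; rewrite /= mem_filter /= => /andP [/eqP].
- apply: filter_uniq; apply: allpairs_uniq; try exact: undup_uniq.
  by move=> [? ?] [? ?].
rewrite big_filter big_mkcond /= big_allpairs /=.
rewrite [LHS]big_seq [RHS]big_seq; apply: eq_bigr => a; rewrite mem_undup => ains.
rewrite [LHS]big_seq [RHS]big_seq; apply: eq_bigr => b; rewrite mem_undup => bint.
rewrite (fs a (allP bs a ains)) (gt b (allP bt b bint)).
by case: eqP; rewrite ?mulr1 ?mulr0.
Qed.

Definition elem_sym_monoms (N k : nat) : seq monom :=
  [seq (seq_mset (map val (enum D)) : monom) |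
     D : {set 'I_N} in [pred D : {set 'I_N} | #|D| == k]].

(** Strictly increasing sequences with values below N are the increasing
enumerations of the subsets of 'I_N. *)
Lemma listed_elem_sym N k : listed_by N (elem_sym k) (elem_sym_monoms N k).
Proof.
have ltn_enum (D : {set 'I_N}) : sorted ltn (map val (enum D)).
  rewrite sorted_map; apply: (subseq_sorted _ _ (s2 := enum 'I_N)).
  - by move=> x y z /=; apply: ltn_trans.
  - by rewrite (enumT 'I_N); apply: filter_subseq.
  - by rewrite -sorted_map val_enum_ord iota_ltn_sorted.
split=> [|m bm].
  apply/allP => _ /mapP [D _ ->]; rewrite bounded_seq_mset.
  by apply/allP => _ /mapP [i _ ->]; apply: ltn_ord.
rewrite natr_count big_map /elem_sym.
rewrite (fsum_list (r := [seq map val (enum D) | D : {set 'I_N} in [pred D : {set 'I_N} | #|D| == k]])).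
- by rewrite big_map; apply: eq_bigr => D _; rewrite /prod_vars /series_of_monom eq_sym.
- rewrite map_inj_uniq ?enum_uniq // => D1 D2 /(inj_map val_inj) eS.
  by apply/setP => i; rewrite -(mem_enum D1) eS mem_enum.
- move=> s /mapP [D]; rewrite mem_enum inE => Sk -> /=.
  by rewrite ltn_enum size_map -cardE.
move=> s /= /andP [s_sorted /eqP s_size] nin; rewrite /prod_vars /series_of_monom.
case: (m =P _) => // ms; case/negP: nin; move: bm; rewrite ms bounded_seq_mset => /allP bs.
pose D := [set i : 'I_N | val i \in s].
have sS : s = map val (enum D).
  apply: (irr_sorted_eq ltn_trans ltnn) => // i; apply/idP/mapP => [is_|[j]].
    by exists (Ordinal (bs i is_)) => //; rewrite mem_enum inE.
  by rewrite mem_enum inE => js ->.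
by apply/mapP; exists D => //; rewrite mem_enum inE cardE -(size_map val) -sS s_size.
Qed.

Lemma listed_chromatic N (V : finType) (e : rel V) :
  listed_by N (chromatic_sym e)
    [seq (seq_mset [seq val (k v) | v : V] : monom)
       | k : {ffun V -> 'I_N} in [pred k : {ffun V -> 'I_N} | is_proper e k]].
Proof.
pose h (k : {ffun V -> 'I_N}) : {ffun V -> nat} := [ffun v => val (k v)].
have h_inj : injective h.
  by move=> k1 k2 /ffunP k12; apply/ffunP => v; have := k12 v; rewrite !ffunE => /val_inj.
have hE k : [seq h k v | v : V] = [seq val (k v) | v : V].
  by apply: eq_map => v; rewrite ffunE.
split=> [|m bm].
  apply/allP => _ /mapP [k _ ->]; rewrite bounded_seq_mset.
  by apply/allP => _ /mapP [v _ ->]; apply: ltn_ord.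
rewrite natr_count big_map /chromatic_sym.
rewrite (fsum_list (r := [seq h k | k : {ffun V -> 'I_N} in [pred k : {ffun V -> 'I_N} | is_proper e k]])).
- by rewrite big_map; apply: eq_bigr => k _; rewrite /prod_vars /series_of_monom hE eq_sym.
- by rewrite map_inj_uniq ?enum_uniq.
- move=> k' /mapP [k]; rewrite mem_enum inE => kP -> x y exy; rewrite !ffunE.
  by have /forallP /(_ x) /forallP /(_ y) := kP; rewrite exy.
move=> k /= kP nin; rewrite /prod_vars /series_of_monom.
case: (m =P _) => // mk; case/negP: nin; move: bm; rewrite mk bounded_seq_mset => /allP bk.
have bkv v : (k v < N)%N by apply: bk; apply/mapP; exists v; rewrite ?mem_enum.
apply/mapP; exists [ffun v => Ordinal (bkv v)]; last by apply/ffunP => v; rewrite !ffunE.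
rewrite mem_enum inE; apply/forallP => x; apply/forallP => y; apply/implyP => exy.
by rewrite !ffunE; apply: kP.
Qed.

Definition elem_sym_eval (R : comNzRingType) (N : nat) (x : nat -> R) (k : nat) : R :=
  \sum_(S : {set 'I_N} | #|S| == k) \prod_(i in S) x i.

Definition elem_sym_part_monoms (N : nat) (l : seq nat) : seq monom :=
  foldr (fun k s => [seq (a `+` b)%mset | a <- elem_sym_monoms N k, b <- s]) [:: mset0] l.

Lemma listed_elem_sym_part N (l : intpart) :
  listed_by N (elem_sym_part l) (elem_sym_part_monoms N (val l)).
Proof.
rewrite /elem_sym_part; elim: (val l) => [|k l' IH].
  by rewrite big_nil; apply: listed_psone.
by rewrite big_cons; apply: listed_psmul (listed_elem_sym N k) IH.
Qed.

Lemma sum_elem_sym_part_monoms (R : comNzRingType) (N : nat) (x : nat -> R) (l : seq nat) :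
  \sum_(a <- elem_sym_part_monoms N l) monom_eval x a
  = \prod_(k <- l) elem_sym_eval N x k.
Proof.
elim: l => [|k l IH]; first by rewrite big_seq1 big_nil /monom_eval enum_mset0 big_nil.
rewrite big_allpairs_dep /= big_cons -IH big_distrl big_map /=.
rewrite big_enum /=; apply: eq_bigr => D _; rewrite big_distrr /=.
apply: eq_bigr => a _; rewrite monom_evalD monom_eval_seq big_map.
by rewrite big_enum.
Qed.

(** Both sides of the expansion are finite combinations of lists of monomials;
grouping equal monomials reduces the claim to the equality of coefficients. *)
Lemma chromatic_eval (F : numFieldType) (N : nat) (x : nat -> F) (V : finType) (e : rel V)
    (c : {fsfun intpart -> rat with 0}) :
  e_expansion (chromatic_sym e) c ->
  \sum_(k : {ffun V -> 'I_N} | is_proper e k) \prod_v x (k v)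
  = \sum_(l <- finsupp c) ratr (c l) * \prod_(k <- val l) elem_sym_eval N x k.
Proof.
move=> cE; have [bX listX] := listed_chromatic N e.
set sX := [seq _ | k in _] in bX listX.
transitivity (\sum_(a <- sX) monom_eval x a).
  rewrite big_map big_enum /=; apply: eq_bigr => k _.
  by rewrite monom_eval_seq big_map big_enum.
pose t (l : intpart) := elem_sym_part_monoms N (val l).
pose U := undup (sX ++ flatten [seq t l | l <- finsupp c]).
have U_uniq : uniq U by apply: undup_uniq.
rewrite (sum_count_undup _ U_uniq); last by move=> a; rewrite mem_undup mem_cat => ->.
under [RHS]eq_big_seq => l lc.
  rewrite -sum_elem_sym_part_monoms (sum_count_undup _ U_uniq) ?big_distrr /=; last first.
    move=> a al; rewrite mem_undup mem_cat; apply/orP; right; apply/flattenP.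
    by exists (t l) => //; apply/map_f.
  over.
rewrite exchange_big /= big_seq [RHS]big_seq; apply: eq_bigr => a aU.
have ba : bounded_monom N a.
  move: aU; rewrite mem_undup mem_cat => /orP [/(allP bX) //|/flattenP [_ /mapP [l _ ->]]].
  by have [/allP bt _] := listed_elem_sym_part N l => /bt.
rewrite -(ratr_nat F) -listX // cE raddf_sum big_distrl /=; apply: eq_bigr => l _.
by have [_ ->] := listed_elem_sym_part N l; rewrite // rmorphM /= ratr_nat mulrA.
Qed.

(** * Newton identities and the two special families *)

Definition power_sum (R : comNzRingType) (N : nat) (x : nat -> R) (k : nat) : R :=
  \sum_(i < N) x i ^+ k.

Definition root_poly (R : comNzRingType) (N : nat) (x : nat -> R) : {poly R} :=
  \prod_(i < N) (1 + x i *: 'X).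

Lemma coef_root_poly (R : comNzRingType) (N : nat) (x : nat -> R) k :
  (root_poly N x)`_k = elem_sym_eval N x k.
Proof.
rewrite /root_poly; under eq_bigr do rewrite addrC.
rewrite bigA_distr coef_sum /elem_sym_eval [RHS]big_mkcond; apply: eq_bigr => D _.
rewrite -big_mkcond /= scaler_prod prodr_const coefZ coefXn eq_sym.
by case: eqP; rewrite ?mulr1 ?mulr0.
Qed.

(** The coefficients of degree less than K form the logarithmic derivative
identity P * sum_k (-1)^k p_(k+1) X^k = P', one factor 1 + y X at a time. *)
Lemma newton_identities (R : comNzRingType) (N : nat) (x : nat -> R) (K : nat) :
  exists Q : {poly R},
    root_poly N x * (\poly_(k < K) ((-1) ^+ k * power_sum N x k.+1))
    = (root_poly N x)^`() + 'X^K * Q.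
Proof.
pose S M := \poly_(k < K) ((-1) ^+ k * power_sum M x k.+1).
suff [Q defQ] : exists Q : {poly R},
    root_poly N x * S N = (root_poly N x)^`() + 'X^K * Q by exists Q.
elim: N => [|M [Q IH]].
  exists 0; rewrite /root_poly big_ord0 derivC mulr0 addr0 mul1r.
  apply/polyP => k; rewrite coef_poly coef0 /power_sum big_ord0 mulr0.
  by case: ifP.
pose y := x M; pose s : {poly R} := \poly_(k < K) ((-1) ^+ k * y ^+ k.+1).
have SS : S M.+1 = S M + s.
  apply/polyP => k; rewrite coefD !coef_poly; case: ifP; rewrite ?addr0 // => _.
  by rewrite /power_sum big_ord_recr /= mulrDr.
have rS : root_poly M.+1 x = root_poly M x * (1 + y *: 'X).
  by rewrite /root_poly big_ord_recr.
(* The geometric sum s is y / (1 + y X) truncated at degree K. *)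
have geom : (1 + y *: 'X) * s = y%:P - 'X^K * (y * (- y) ^+ K)%:P.
  apply/polyP => k; rewrite mulrDl mul1r -scalerAl coefB coefD coefZ coefXM coefXnM.
  rewrite !coef_poly !coefC.
  case: k => [|k] /=.
    rewrite mulr0 addr0; case: (posnP K) => [->|K_gt0].
      by rewrite /= !expr0 mulr1 subrr.
    by rewrite subr0 mul1r expr1.
  have [kK|kK|kK] := ltngtP k.+1 K.
  - rewrite subr0 !exprS; ring.
  - by rewrite mulr0 subn_eq0 leqNgt kK /= subr0 addr0.
  - rewrite -kK subnn eqxx -[- y]mulN1r exprMn !exprS; ring.
exists (Q * (1 + y *: 'X) - root_poly M x * (y * (- y) ^+ K)%:P).
rewrite rS SS derivM derivD derivC add0r derivZ derivX alg_polyC.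
transitivity ((1 + y *: 'X) * (root_poly M x * S M) + root_poly M x * ((1 + y *: 'X) * s)).
  ring.
rewrite IH geom; ring.
Qed.

(** The roots of P are non-zero since P(0) = 1, and x consists of the opposites of their
inverses.  A final zero keeps the family non-empty even when P = 1. *)
Lemma exists_root_poly (F : closedFieldType) (P : {poly F}) : P`_0 = 1 ->
  exists N x, (0 < N)%N /\ root_poly N x = P.
Proof.
move=> P0; have [r Pr] := closed_field_poly_normal P.
have c1 : lead_coef P * \prod_(z <- r) - z = 1.
  transitivity P.[0]; last by rewrite horner_coef0.
  rewrite [in RHS]Pr hornerZ horner_prod; congr (_ * _).
  by apply: eq_bigr => z _; rewrite hornerXsubC sub0r.
have r0 z : z \in r -> z != 0.
  move=> zr; apply/eqP => z0; move/eqP: c1; rewrite (big_rem z zr) /= z0 oppr0 mul0r mulr0.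
  by rewrite eq_sym oner_eq0.
pose s := [seq - z^-1 | z <- r].
exists (size s).+1, (fun i => s`_i); split => //.
rewrite /root_poly big_ord_recr /= nth_default // scale0r addr0 mulr1.
rewrite -(big_mkord xpredT (fun i => 1 + s`_i *: 'X)) -(big_nth 0 xpredT (fun y => 1 + y *: 'X)).
rewrite big_map [RHS]Pr -[lead_coef P]mulr1.
have -> : 1 = \prod_(z <- r) - z * \prod_(z <- r) - z^-1 :> F.
  rewrite -big_split /= big_seq big1 // => z zr.
  by rewrite mulrNN divff ?r0.
rewrite mulrA c1 mul1r -scaler_prod big_seq [RHS]big_seq; apply: eq_bigr => z zr.
rewrite scalerBr -alg_polyC scalerA mulNr mulVf ?r0 // !scaleNr scale1r opprK addrC.
by rewrite -scaleNr.
Qed.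

Section Specialization.
Variables (R : comNzRingType) (d : nat).
Hypothesis d_gt4 : (4 < d)%N.

Definition special_poly (a : R) : {poly R} := 1 + 'X^2 + a *: 'X^d.

Lemma coef_special_poly a k :
  (special_poly a)`_k = (k == 0)%:R + (k == 2)%:R + a * (k == d)%:R.
Proof. by rewrite !coefD coefZ coef1 !coefXn. Qed.

Lemma special_recurrence N x a k : root_poly N x = special_poly a -> (k < d.+4)%N ->
  let q j := (-1) ^+ j * power_sum N x j.+1 in
  q k + (if (k < 2)%N then 0 else q (k - 2)%N)
      + a * (if (k < d)%N then 0 else q (k - d)%N)
  = ((k == 1)%:R + a * (k.+1 == d)%:R) *+ k.+1.
Proof.
move=> xP km q; have [Q /(congr1 (fun p : {poly R} => p`_k))] := newton_identities N x d.+4.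
rewrite xP coefD coef_deriv coefXnM km addr0 coef_special_poly !eqSS /= add0r => <-.
rewrite /special_poly !mulrDl mul1r -scalerAl !coefD coefZ !coefXnM !coef_poly km.
have lt j : (k - j < d.+4)%N by apply: leq_ltn_trans km; apply: leq_subr.
by rewrite !lt.
Qed.

Section SmallPowerSums.
Variables (N : nat) (x : nat -> R) (a : R).
Hypothesis xP : root_poly N x = special_poly a.

Lemma small_power_sums :
  [/\ power_sum N x 1 = 0, power_sum N x 2 = - 2%:R,
      power_sum N x 3 = 0 & power_sum N x 4 = 2%:R].
Proof.
pose q j := (-1) ^+ j * power_sum N x j.+1.
have rec k : (k < 4)%N ->
    q k + (if (k < 2)%N then 0 else q (k - 2)%N) = (k == 1)%:R *+ k.+1.
  move=> k4; have kd : (k < d)%N by lia.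
  have := special_recurrence xP (ltn_trans kd (ltnW (ltnW (ltnW (ltnSn _))))).
  have -> : (k.+1 == d) = false by lia.
  by rewrite /= kd !mulr0 !addr0.
have := rec 0 isT; rewrite /= addr0 mul0rn /q expr0 mul1r => p1.
have := rec 1 isT; rewrite /= addr0 /q expr1 mulN1r => p2.
have := rec 2 isT; rewrite /= mul0rn subnn /q expr0 mul1r p1 addr0 sqrrN expr1n mul1r => p3.
have := rec 3 isT; rewrite /= mul0rn -[(3 - 2)%N]/(1%N) /q expr1 mulN1r p2 => p4.
split=> //; first by rewrite -p2 opprK.
by apply/eqP; rewrite -subr_eq0 -oppr_eq0 -[X in _ == X]p4; apply/eqP; ring.
Qed.
End SmallPowerSums.

(** The two recurrences differ only by the term of index k - d and by the
coefficient of X^d, so the difference is d at index d and then propagates with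
alternating sign in steps of two, corrected by p_2 and p_4. *)
Lemma power_sum_difference N0 x0 N1 x1 :
  root_poly N0 x0 = special_poly 0 -> root_poly N1 x1 = special_poly 1 ->
  forall k, (k < d.+4)%N -> 
  (-1) ^+ k * (power_sum N1 x1 k.+1 - power_sum N0 x0 k.+1)
  = if k.+1 == d then d%:R else if k.+1 == d.+2 then - d.+2%:R 
    else if k.+1 == d.+4 then d.+4%:R else 0.
Proof.
move=> x0P x1P; have [p1 p2 p3 p4] := small_power_sums x1P.
pose D k := (-1) ^+ k * (power_sum N1 x1 k.+1 - power_sum N0 x0 k.+1).
rewrite -/D; elim/ltn_ind => k IH kd; rewrite -/(D k).
have := special_recurrence x1P kd; rewrite /= !mul1r.
have := special_recurrence x0P kd; rewrite /= !mul0r !addr0 => r0 r1.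
have {r0 r1} : D k + (if (k < 2)%N then 0 else D (k - 2)%N)
   + (if (k < d)%N then 0 else (-1) ^+ (k - d) * power_sum N1 x1 (k - d).+1)
   = (k.+1 == d)%:R *+ k.+1.
  move: r1; rewrite mulrnDl -r0 => r1; apply/eqP.
  by move: r1; case: ifP => _; case: ifP => _; rewrite /D => /eqP; rewrite -subr_eq0 => /eqP r1;
    rewrite -subr_eq0 -[X in _ == X]r1; apply/eqP; ring.
have IH2 : ~~ (k < 2)%N -> D (k - 2)%N = if (k == d.+1)%N then d%:R else
   if (k == d.+3)%N then - d.+2%:R else 0.
  move=> k2; rewrite /D IH; [|lia|lia].
  have -> : ((k - 2).+1 == d) = (k == d.+1) by lia.
  have -> : ((k - 2).+1 == d.+2) = (k == d.+3) by lia.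
  by have -> : ((k - 2).+1 == d.+4) = false by lia.
have [kd'|kd'] := ltnP k d.
  have -> : (k.+1 == d.+2) = false by lia.
  have -> : (k.+1 == d.+4) = false by lia.
  move: IH2; have -> : (k == d.+1) = false by lia.
  have -> : (k == d.+3) = false by lia.
  case: (k < 2)%N => [_|/(_ isT) ->]; rewrite !addr0 => ->; by case: eqP => [->|_]; rewrite ?mul0rn.
have kE : k = (k - d + d)%N by lia.
have : (k - d < 4)%N by lia.
have -> : (k < 2)%N = false by lia.
rewrite IH2; last by lia.
move: kE; move: (k - d)%N => j ->.
have ne : ((d == d.+1) = false) * ((d == d.+2) = false) * ((d == d.+3) = false)
    * ((d.+1 == d) = false) * ((d.+2 == d) = false) * ((d.+3 == d) = false)
    * ((d.+4 == d) = false).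
  by do !split; lia.
have solve (u v w t z : R) : u + v + w = t -> t - v - w = z -> u = z.
  by move=> <- <-; ring.
by case: j => [|[|[|[|j]]]] //= _; rewrite ?(add0n, add1n, add2n, add3n) !eqSS ?eqxx ?ne
  ?(p1, p2, p3, p4) => /solve; apply; rewrite mul0rn; ring.
Qed.
(** With p_1 = 0, only partitions without parts equal to 1 matter below. *)
Lemma partition_of_two (l : seq nat) :
  all (leq 1) l -> sumn l = 2 -> 1 \notin l -> l = [:: 2].
Proof.
case: l => [|a [|b l]] //=; rewrite !inE; first by rewrite addn0 => _ ->.
by lia.
Qed.

Lemma partition_of_four (l : seq nat) :
  all (leq 1) l -> sumn l = 4 -> 1 \notin l -> l = [:: 4] \/ l = [:: 2; 2].
Proof.
case: l => [|a [|b [|c l]]] //=; rewrite !inE.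
- by rewrite addn0 => _ -> _; left.
- move=> pos ab4 ab1; right; have -> : a = 2 by lia.
  by have -> : b = 2 by lia.
by lia.
Qed.

Lemma perm_eq_cons_large (h g : nat) (l t : seq nat) :
  (d <= h)%N -> all (fun k => (k < d)%N) t ->
  perm_eq (h :: l) (g :: t) = (h == g) && perm_eq l t.
Proof.
move=> dh tsmall; have [->|hg] := eqVneq h g; first by rewrite perm_cons.
apply/negP => /perm_mem /(_ h); rewrite !inE eqxx (negbTE hg) /= => /esym ht.
by have := allP tsmall h ht; rewrite ltnNge dh.
Qed.

(** At most one entry of l reaches d because 2 d > d + 4.  If none does, or if
it is d+1 or d+3, the products agree.  Otherwise the other entries add up to 4, 2 or 0,
and the vanishing of p_1 leaves only 4, 2 + 2 and 2. *)
Lemma power_sum_product_difference N0 x0 N1 x1 (l : seq nat) :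
  root_poly N0 x0 = special_poly 0 -> root_poly N1 x1 = special_poly 1 ->
  all (leq 1) l -> sumn l = d.+4 ->
  (-1) ^+ (d.+4 - size l) *
    (\prod_(k <- l) power_sum N1 x1 k - \prod_(k <- l) power_sum N0 x0 k)
  = (d.+4 * perm_eq l [:: d.+4])%:R + (4 * d * perm_eq l [:: d; 2; 2])%:R
    - (2 * d.+2 * perm_eq l [:: d.+2; 2])%:R - (2 * d * perm_eq l [:: d; 4])%:R :> R.
Proof.
move=> x0P x1P.
have [p01 p02 p03 p04] := small_power_sums x0P.
have [p11 p12 p13 p14] := small_power_sums x1P.
have diff k : (0 < k)%N -> (k <= d.+4)%N -> power_sum N1 x1 k = power_sum N0 x0 k +
    (-1) ^+ k.-1 * (if k == d then d%:R else if k == d.+2 then - d.+2%:R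
    else if k == d.+4 then d.+4%:R else 0).
  case: k => // k _ kd; rewrite -(power_sum_difference x0P x1P) //= mulrA -expr2 sqrr_sign.
  by rewrite mul1r addrC subrK.
have same k : (0 < k)%N -> (k <= d.+4)%N -> k != d -> k != d.+2 -> k != d.+4 ->
    power_sum N1 x1 k = power_sum N0 x0 k.
  by move=> k0 k4 /negbTE kd /negbTE kd2 /negbTE kd4; rewrite diff // kd kd2 kd4 mulr0 addr0.
have same_small l' : all (leq 1) l' -> all (fun k => (k < d)%N) l' ->
    \prod_(k <- l') power_sum N1 x1 k = \prod_(k <- l') power_sum N0 x0 k.
  move=> /allP pos /allP small; apply: eq_big_seq => k kl.
  by have k0 := pos k kl; have kd := small k kl; apply: same; lia.
have [small|/allPn [h hl]] := boolP (all (fun k => (k < d)%N) l).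
  move=> pos _; rewrite same_small // subrr mulr0.
  have notperm g t : (d <= g)%N -> perm_eq l (g :: t) = false.
    move=> dg; apply/negP => /perm_mem /(_ g); rewrite mem_head => /(allP small).
    by rewrite ltnNge dg.
  by rewrite !notperm ?muln0 ?subr0 ?addr0 //; lia.
rewrite -leqNgt => dh pos sum_l.
have lP := perm_to_rem hl; set l' := rem h l in lP.
rewrite !(perm_big _ lP) (perm_size lP) /= !(permPl lP) !big_cons.
move: pos sum_l; rewrite (perm_all _ lP) (perm_sumn lP) /= => /andP [h0 pos] sum_l.
have small : all (fun k => (k < d)%N) l'.
  apply/allP => k kl; have : (k <= sumn l')%N.
    by rewrite (perm_sumn (perm_to_rem kl)) /= leq_addr.
  by lia.
rewrite !perm_eq_cons_large //=; try lia.
rewrite (same_small l') // -mulrBl.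
have [l1|l1] := boolP (1 \in l').
  rewrite [\prod_(k <- l') _](big_rem 1) //= p01 mul0r !mulr0.
  have notperm t : 1 \notin t -> perm_eq l' t = false.
    by move=> t1; apply: contraNF t1 => /perm_mem <-.
  by rewrite !notperm // !andbF !muln0 !addr0 !subr0.
set s : R := (-1) ^+ d; have ss : s * s = 1 by rewrite -expr2 sqrr_sign.
have sd : (-1) ^+ d.-1 = - s by rewrite /s -[in RHS](prednK (ltn_trans _ d_gt4)) // exprS mulN1r opprK.
have [hd|hd] := eqVneq h d.
  have suml' : sumn l' = 4 by lia.
  have -> : (h == d.+4) = false by lia.
  have -> : (h == d.+2) = false by lia.
  rewrite diff ?hd ?eqxx ?sd; try lia.
  case: (partition_of_four pos suml' l1) => ->; rewrite !big_cons big_nil ?p02 ?p04 /= !subSS subn0.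
    by rewrite !exprS -/s; transitivity (- (s * s) * 2%:R * d%:R); [ring|rewrite ss; ring].
  by rewrite !exprS -/s; transitivity ((s * s) * 4%:R * d%:R); [ring|rewrite ss; ring].
have [hd2|hd2] := eqVneq h d.+2.
  have suml' : sumn l' = 2 by lia.
  have -> : (h == d.+4) = false by lia.
  rewrite diff ?(negbTE hd) ?hd2 ?eqxx; try lia.
  rewrite (partition_of_two pos suml' l1) !big_cons big_nil ?p02 /= !subSS subn0.
  by rewrite !exprS -/s; transitivity (- (s * s) * 2%:R * d.+2%:R); [ring|rewrite ss; ring].
have [hd4|hd4] := eqVneq h d.+4.
  have -> : l' = [::] by case: (l') pos sum_l => //= k l'' /andP [k0 _] sum_l; lia.
  rewrite diff ?(negbTE hd) ?(negbTE hd2) ?hd4 ?eqxx; try lia.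
  rewrite !big_nil /= !subSS subn0 !exprS -/s.
  by transitivity ((s * s) * d.+4%:R); [ring|rewrite ss; ring].
by rewrite same //; [rewrite subrr mul0r mulr0 /= !muln0 !addr0 !subr0|lia].
Qed.
End Specialization.

(** * Positivity of the coefficient of e_(d,2,2) *)

Lemma e_positive_monotone (F : numFieldType) (V : finType) (e : rel V)
    (N0 N1 : nat) (x0 x1 : nat -> F) :
  e_positive e ->
  (forall k, 0 <= elem_sym_eval N0 x0 k <= elem_sym_eval N1 x1 k) ->
  \sum_(k : {ffun V -> 'I_N0} | is_proper e k) \prod_v x0 (k v)
  <= \sum_(k : {ffun V -> 'I_N1} | is_proper e k) \prod_v x1 (k v).
Proof.
move=> [c [cE c0]] le01; rewrite !(chromatic_eval _ _ cE); apply: ler_sum => l _.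
apply: ler_wpM2l; first by rewrite ler0q.
by apply: ler_prod => k _.
Qed.

Definition block_sizes (V : finType) (P : {set {set V}}) : seq nat :=
  [seq #|B| | B : {set V} in P].

Lemma nb_connected_partitions_sum (V : finType) (e : rel V) l :
  nb_connected_partitions e l =
  (\sum_(P | connected_partition e P) perm_eq (block_sizes P) l)%N.
Proof.
rewrite /nb_connected_partitions cardsE -sum1_card big_mkcondr /=.
by apply: eq_bigr => P _; rewrite /has_type /block_sizes; case: perm_eq.
Qed.

Lemma sumn_block_sizes (V : finType) (P : {set {set V}}) :
  partition P [set: V] -> sumn (block_sizes P) = #|V|.
Proof.
by move=> partP; rewrite sumnE big_map big_enum /= -(card_partition partP) cardsT.
Qed.

Lemma block_sizes_gt0 (V : finType) (P : {set {set V}}) :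
  partition P [set: V] -> all (leq 1) (block_sizes P).
Proof.
move=> /and3P [_ _ P0]; apply/allP => k /mapP [B]; rewrite mem_enum => BP ->.
by rewrite card_gt0; apply: contraNneq P0 => <-.
Qed.

Lemma nb_one_block_le1 (V : finType) (e : rel V) :
  (nb_connected_partitions e [:: #|V|] <= 1)%N.
Proof.
rewrite -(cards1 [set [set: V]]); apply: subset_leq_card; apply/subsetP => P.
rewrite inE => /andP [/andP [/and3P [/eqP covP _ _] _] /perm_size].
rewrite size_map -cardE /= => /eqP /cards1P [B PB].
by rewrite inE PB -covP PB /cover big_set1.
Qed.

(** The coefficient of e_(d,2,2) in the chromatic symmetric function is
non-negative. *)
Lemma e_positive_tree_inequality (V : finType) (e : rel V) (d : nat) :
  (4 < d)%N -> #|V| = d.+4 -> is_tree e -> e_positive e ->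
  (2 * d.+2 * nb_connected_partitions e [:: d.+2; 2]
     + 2 * d * nb_connected_partitions e [:: d; 4]
   <= d.+4 * nb_connected_partitions e [:: d.+4]
     + 4 * d * nb_connected_partitions e [:: d; 2; 2])%N.
Proof.
move=> d_gt4 cardV e_tree e_pos.
have P0 (a : algC) : (special_poly d a)`_0 = 1.
  have d0 : (0%N == d) = false by lia.
  by rewrite coef_special_poly d0 mulr0 !addr0.
have [N0 [x0 [N0_gt0 x0P]]] := exists_root_poly (P0 0).
have [N1 [x1 [N1_gt0 x1P]]] := exists_root_poly (P0 1).
have le01 k : 0 <= elem_sym_eval N0 x0 k <= elem_sym_eval N1 x1 k.
  rewrite -!coef_root_poly x0P x1P !coef_special_poly mul0r mul1r addr0 lerDl.
  by rewrite addr_ge0 ?ler0n.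
have := e_positive_monotone e_pos le01; rewrite -subr_ge0.
rewrite (tree_power_sum_expansion e_tree (Ordinal N0_gt0) (fun i => x0 i)).
rewrite (tree_power_sum_expansion e_tree (Ordinal N1_gt0) (fun i => x1 i)).
rewrite -sumrB => ge0.
rewrite -(ler_nat algC) -subr_ge0; congr (0 <= _): ge0.
pose t l P := perm_eq (@block_sizes V P) l.
transitivity (\sum_(P | connected_partition e P)
   ((d.+4 * t [:: d.+4] P)%:R + (4 * d * t [:: d; 2%N; 2%N] P)%:R
    - (2 * d.+2 * t [:: d.+2; 2%N] P)%:R - (2 * d * t [:: d; 4%N] P)%:R : algC)).
  apply: eq_bigr => P /andP [partP _].
  rewrite -(power_sum_product_difference d_gt4 x0P x1P) ?block_sizes_gt0 //.
    by rewrite size_map -cardE cardV mulrBr !big_map !big_enum.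
  by rewrite sumn_block_sizes.
rewrite !sumrB big_split /= -!natr_sum -!big_distrr /= -!nb_connected_partitions_sum.
by rewrite (natrD _ (d.+4 * _)) (natrD _ (2 * d.+2 * _)) opprD addrA.
Qed.

Theorem theorem3p1 (V : finType) (e : rel V) (n : nat)
    (card_V : #|V| = n) (n_ge9 : (9 <= n)%N)
    (e_tree : is_tree e) (e_pos : e_positive e) :
  let b := nb_connected_partitions e in
  (Num.ceil ((b [:: n - 2; 2] + b [:: n - 4; 4])%N%:R / 2%:R : rat)
     <= (b [:: n - 4; 2; 2])%N%:Z)%R.
Proof.
cbv zeta; set b := nb_connected_partitions e; rewrite ceil_le_int ler_pdivrMr ?ltr0n // -natrM ler_nat.
have d_gt4 : (4 < n - 4)%N by lia.
have nE : n = (n - 4).+4 by lia.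
have := e_positive_tree_inequality d_gt4 (etrans card_V nE) e_tree e_pos.
have := nb_one_block_le1 e; rewrite card_V.
rewrite -nE; have -> : (n - 4).+2 = (n - 2)%N by lia.
rewrite -/b; move: (b _) (b _) (b _) (b _) => b1 b2 b3 b4 b4_le1.
(* The term n b_(n) costs less than one unit after division by 2 (n - 4). *)
nia.
Qed.
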